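(* Let $C$ be a finite set of $N$ pick-up points, each $c\in C$ having a probability $P(c)\in[0,1]$, and write $\overline{P(c)}=1-P(c)$. Let $D_{x,y}$ denote the distance between locations $x,y$. For a potential sequence $\vec r=\langle c_1,\dots,c_L\rangle$ (distinct elements of $C$, $L\ge 1$) define $$F1(\vec r)=\sum_{j=2}^{L}\Big(\sum_{i=2}^{j}D_{c_{i-1},c_i}\Big)\Big(\prod_{i=2}^{j-1}\overline{P(c_i)}\Big)P(c_j)$$ (so $F1(\vec r)=0$ when $L=1$) and $$PE(\vec r)=\sum_{j=1}^{L}\Big(\prod_{i=1}^{j-1}\overline{P(c_i)}\Big)P(c_j)=1-\prod_{i=1}^{L}\overline{P(c_i)}.$$ Let $\vec r_1=\langle c_1,c_2,\dots,c_k\rangle$ be a potential sequence with $2\le k\le N$ and let $\vec r_2=\langle c_2,\dots,c_k\rangle$ be its postfix sub-sequence. Then $$F1(\vec r_1)=\overline{P(c_2)}\cdot F1(\vec r_2)+D_{c_1,c_2}\cdot PE(\vec r_2).$$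
   Context: A potential sequence is a finite sequence of pairwise distinct pick-up points from $C$. $F1$ is called the PTD sub-function of the sequence and $PE$ its probability summation. Empty products equal $1$. *)

(* Defs.v *)
From mathcomp Require Import all_boot all_order all_algebra.
From mathcomp Require Import reals.

Set Implicit Arguments.
Unset Strict Implicit.
Unset Printing Implicit Defensive.

Import Order.TTheory GRing.Theory Num.Theory.
Local Open Scope ring_scope.

Definition potential_sequence (C : finType) (r : seq C) : bool := uniq r.

Section PTD.
Variables (R : realType) (C : finType).
Variable D : C -> C -> R.
Variable P : C -> R.

(* [<c_1, ..., c_L>] is a [seq], which is numbered from 0, so c_i is the entry
   [i.-1].  The default [c0] of [nth] is never reached for 1 <= i <= L.  On the
   empty sequence, where F1 and PE have no intended meaning, both are 0. *)
Definition F1 (r : seq C) : R :=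
  if r is c0 :: _ then
    let c i := nth c0 r i.-1 in
    \sum_(2 <= j < (size r).+1)
      (\sum_(2 <= i < j.+1) D (c i.-1) (c i)) *
      (\prod_(2 <= i < j) (1 - P (c i))) * P (c j)
  else 0.

Definition PE (r : seq C) : R :=
  if r is c0 :: _ then
    let c i := nth c0 r i.-1 in
    \sum_(1 <= j < (size r).+1) (\prod_(1 <= i < j) (1 - P (c i))) * P (c j)
  else 0.

Lemma F1_seq1 c1 : F1 [:: c1] = 0.
Proof. by rewrite /F1 big_geq. Qed.

Lemma PE_prod (r : seq C) : PE r = 1 - \prod_(c <- r) (1 - P c).
Proof.
case: r => [|c0 s]; first by rewrite big_nil subrr.
rewrite (big_nth c0) /PE; set r := c0 :: s.
elim: (size r) => [|n IHn]; first by rewrite !big_geq // subrr.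
rewrite big_nat_recr //= IHn [in RHS]big_nat_recr //= big_add1 /=.
by rewrite mulrBr mulr1 opprB addrA addrAC.
Qed.

End PTD.

(* Main.v *)
Require Import Defs.
From mathcomp Require Import all_boot all_order all_algebra.
From mathcomp Require Import reals.

Set Implicit Arguments.
Unset Strict Implicit.
Unset Printing Implicit Defensive.

Import Order.TTheory GRing.Theory Num.Theory.
Local Open Scope ring_scope.

(** Every route of [r1] starts with the leg from [c1] to [c2], so the distance to a later point is
    [D c1 c2] plus the distance along [r2]. Distributing over this sum, the constant leg collects
    the weights that add up to [PE] of [r2]. In the remaining part the first point of [r2]
    contributes distance 0, and every other weight contains the factor [1 - P c2], leaving [F1] of
    [r2]. *)

(* The default of [nth] in [F1] is the head of the sequence, hence differs
   between <c_1, ..., c_k> and <c_2, ..., c_k>. *)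
Lemma F1_nth (R : realType) (C : finType) (D : C -> C -> R) (P : C -> R)
    (x0 : C) (r : seq C) :
  F1 D P r = \sum_(2 <= j < (size r).+1)
    (\sum_(2 <= i < j.+1) D (nth x0 r i.-2) (nth x0 r i.-1)) *
    (\prod_(2 <= i < j) (1 - P (nth x0 r i.-1))) * P (nth x0 r j.-1).
Proof.
case: r => [|c0 s]; first by rewrite big_geq.
rewrite /F1; set r := c0 :: s.
have nthE i : (0 < i <= size r)%N -> nth c0 r i.-1 = nth x0 r i.-1.
  by case: i => // i /= lt_ir; apply: set_nth_default.
apply: eq_big_nat => j /andP[j_ge2 j_le]; rewrite nthE ?(ltnW j_ge2) //.
congr (_ * _ * _); apply: eq_big_nat => i /andP[i_ge2 i_lt].
  have i_le : (i <= size r)%N by exact: leq_trans i_lt j_le.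
  by rewrite !nthE //; case: i i_ge2 i_le {i_lt} => [|[|i]] //= _ /ltnW.
by rewrite nthE // (ltnW i_ge2); apply: leq_trans (ltnW i_lt) j_le.
Qed.

Theorem theorem1 (R : realType) (C : finType) (N : nat) (cardC : #|C| = N)
    (P : C -> R) (P01 : forall c, 0 <= P c <= 1) (D : C -> C -> R)
    (k : nat) (k_bounds : (2 <= k <= N)%N)
    (c1 c2 : C) (s r1 r2 : seq C)
    (r1E : r1 = [:: c1, c2 & s]) (size_r1 : size r1 = k)
    (r1_potential : potential_sequence r1)
    (r2E : r2 = c2 :: s) :
  F1 D P r1 = (1 - P c2) * F1 D P r2 + D c1 c2 * PE P r2.
Proof.
(* Default [c2] is the one that unfolding on [r2] produces, so both sides read entries alike. *)
rewrite {}r2E {r1_potential size_r1}r1E (F1_nth D P c2) /F1 /PE.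
set m := size (c2 :: s); pose d i := nth c2 (c2 :: s) i.-1.
pose T j := \sum_(2 <= i < j.+1) D (d i.-1) (d i).
pose Q j := \prod_(1 <= i < j) (1 - P (d i)).
have -> : \sum_(2 <= j < (size [:: c1, c2 & s]).+1)
    (\sum_(2 <= i < j.+1)
       D (nth c2 [:: c1, c2 & s] i.-2) (nth c2 [:: c1, c2 & s] i.-1)) *
    (\prod_(2 <= i < j) (1 - P (nth c2 [:: c1, c2 & s] i.-1))) *
    P (nth c2 [:: c1, c2 & s] j.-1) =
  \sum_(1 <= j < m.+1) (D c1 c2 + T j) * Q j * P (d j).
  (* Position [j.+1] of [r1] is position [j] of [r2]; the leg [i = 2] of [r1] splits off as
     [D c1 c2]. *)
  rewrite big_add1; apply: eq_big_nat => -[//|j] _.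
  congr (_ * _ * _).
    rewrite big_ltn // big_add1; congr (_ + _).
    by apply: eq_big_nat => -[|[|i]].
  by rewrite big_add1; apply: eq_big_nat => -[|i].
under eq_bigr do rewrite -mulrA mulrDl.
(* The summand with the constant leg is [D c1 c2 * PE P r2] by conversion. *)
rewrite big_split /= -mulr_sumr addrC; congr (_ + _).
have T1 : T 1%N = 0 by rewrite /T big_geq.
rewrite big_ltn // T1 mul0r add0r mulr_sumr.
apply: eq_big_nat => j /andP[j_ge2 _].
(* Since [2 <= j], the product [Q j] has a factor at [i = 1], which is [1 - P c2]. *)
by rewrite /Q big_ltn //= -!mulrA [RHS]mulrCA.
Qed.
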